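(* Let $(X,d)$ and $(Y,\rho)$ be quasi-metric spaces. If $f:(X,d)\to(Y,\rho)$ is left K-Cauchy regular, then $f:(X,d^s)\to(Y,\rho^s)$ is a Cauchy regular map between metric spaces.
   Context: A quasi-metric on a set $X$ is a function $d:X\times X\to\mathbb{R}$ such that for all $x,y,z\in X$: $d(x,y)\ge 0$ and $d(x,x)=0$; $d(x,y)=0=d(y,x)$ implies $x=y$; and $d(x,y)\le d(x,z)+d(z,y)$ (symmetry is not required). The associated metric of $d$ is $d^s(x,y)=\max\{d(x,y),d(y,x)\}$, and similarly $\rho^s$ for $\rho$. A sequence $(x_n)$ in $(X,d)$ is left K-Cauchy if for every $\epsilon>0$ there is $n_0\in\mathbb{N}$ such that $d(x_k,x_n)<\epsilon$ whenever $n_0\le k\le n$. A map $f:(X,d)\to(Y,\rho)$ is left K-Cauchy regular if it maps every left K-Cauchy sequence in $(X,d)$ to a left K-Cauchy sequence in $(Y,\rho)$. A map between metric spaces is Cauchy regular if it maps Cauchy sequences to Cauchy sequences. *)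

(* Defs.v *)
From HB Require Import structures.
From mathcomp Require Import all_boot all_order all_algebra.
From mathcomp Require Import all_classical all_reals all_analysis.

Set Implicit Arguments.
Unset Strict Implicit.
Unset Printing Implicit Defensive.

Import Order.TTheory GRing.Theory Num.Theory.

Local Open Scope classical_set_scope.
Local Open Scope ring_scope.

Record quasi_metric (R : realType) (X : Type) := QuasiMetric {
  qdist :> X -> X -> R;
  qdist_ge0 : forall x y, 0 <= qdist x y;
  qdistxx : forall x, qdist x x = 0;
  qdist_sep : forall x y, qdist x y = 0 -> qdist y x = 0 -> x = y;
  qdist_triangle : forall x y z, qdist x y <= qdist x z + qdist z y }.

Section symmetrization.
Context {R : realType} {X : Type}.
Implicit Type d : quasi_metric R X.

Definition sym_dist d (x y : X) : R := Num.max (d x y) (d y x).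

(* The metric space (X, d^s): an alias of X whose metricType structure has
   sym_dist d as its distance. *)
Definition sym_space d : Type := X.

Variable d : quasi_metric R X.

HB.instance Definition _ := gen_eqMixin (sym_space d).
HB.instance Definition _ := gen_choiceMixin (sym_space d).

Let sym_dist_eq0 (x y : sym_space d) : sym_dist d x y = 0 -> x = y.
Proof.
move=> dxy0; apply: (@qdist_sep _ _ d); apply/eqP.
  by rewrite eq_le qdist_ge0 andbT -dxy0 le_max lexx.
by rewrite eq_le qdist_ge0 andbT -dxy0 le_max lexx orbT.
Qed.

Let sym_distxx (x : sym_space d) : sym_dist d x x = 0.
Proof. by rewrite /sym_dist qdistxx maxxx. Qed.

Let sym_distC (x y : sym_space d) : sym_dist d x y = sym_dist d y x.
Proof. exact: maxC. Qed.

Let sym_dist_triangle (y x z : sym_space d) :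
  sym_dist d x z <= sym_dist d x y + sym_dist d y z.
Proof.
rewrite ge_max; apply/andP; split.
  by apply: le_trans (qdist_triangle d x z y) _; rewrite lerD// le_max lexx.
apply: le_trans (qdist_triangle d z x y) _.
by rewrite addrC lerD// le_max lexx orbT.
Qed.

HB.instance Definition _ := @isMetric.Build R (sym_space d) (sym_dist d)
  sym_distxx sym_dist_eq0 sym_distC sym_dist_triangle.

Lemma mdist_symE (x y : sym_space d) : mdist x y = sym_dist d x y.
Proof. by []. Qed.

End symmetrization.

Definition left_K_cauchy (R : realType) (X : Type) (d : quasi_metric R X)
    (u : nat -> X) :=
  forall e : R, 0 < e -> exists n0 : nat,
    forall k n : nat, (n0 <= k)%N -> (k <= n)%N -> d (u k) (u n) < e.

Definition left_K_cauchy_regular (R : realType) (X Y : Type)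
    (d : quasi_metric R X) (rho : quasi_metric R Y) (f : X -> Y) :=
  forall u : nat -> X, left_K_cauchy d u -> left_K_cauchy rho (f \o u).

Definition cauchy_regular (R : realType) (M N : metricType R) (f : M -> N) :=
  forall u : nat -> M, cauchy (u @ \oo) -> cauchy ((f \o u) @ \oo).
Arguments cauchy_regular {R} M N f.

(* Main.v *)
(** Suppose [u] is Cauchy for [d^s] but [f \o u] is not Cauchy for [rho^s].
    Then for some [e > 0] there are, for every [N], indices [a N, b N >= N] with
    [rho (f (u (a N))) (f (u (b N))) >= e].  The interleaved sequence
    [u (a 0), u (b 0), u (a 1), u (b 1), ...] is still Cauchy for [d^s], hence
    left K-Cauchy for [d]; but its image under [f] makes a [rho]-step of size
    at least [e] from each even position to the next, so it is not left
    K-Cauchy. *)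
Require Import Defs.
From mathcomp Require Import all_boot all_order all_algebra.
From mathcomp Require Import all_classical all_reals all_analysis.

Import Order.TTheory GRing.Theory Num.Theory.

Local Open Scope classical_set_scope.
Local Open Scope ring_scope.

(** As [m] and [n] range over both orders, bounding [d] alone bounds the maximum of its two
    directions. *)
Lemma sym_cauchyP (R : realType) (X : Type) (d : quasi_metric R X)
    (u : nat -> sym_space d) :
  cauchy (u @ \oo) <->
  forall e : R, 0 < e -> exists N : nat,
    forall m n : nat, (N <= m)%N -> (N <= n)%N -> d (u m) (u n) < e.
Proof.
rewrite -cauchy_ballP; split=> uC e e0.
  have [[A B] /= [[N _ NA] [M _ MB]] AB] := uC e e0.
  exists (maxn N M) => m n; rewrite !geq_max => /andP[Nm _] /andP[_ Mn].
  have := AB (u m, u n) (conj (NA m Nm) (MB n Mn)).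
  by rewrite /= ballEmdist /= mdist_symE /sym_dist gt_max => /andP[].
have [N NP] := uC e e0.
exists (u @` [set n | (N <= n)%N], u @` [set n | (N <= n)%N]).
  by split; exists N => // n Nn; exists n.
move=> [_ _] /= [[m Nm <-] [n Nn <-]].
by rewrite ballEmdist /= mdist_symE /sym_dist gt_max !NP.
Qed.

(** The bound on [d] ignores the order of the indices, so divergence of [s] suffices; the
    interleaving below may fail to be monotone. *)
Lemma sym_cauchy_comp_left_K (R : realType) (X : Type) (d : quasi_metric R X)
    (u : nat -> sym_space d) (s : nat -> nat) :
  cauchy (u @ \oo) -> s @ \oo --> \oo -> left_K_cauchy d (u \o s).
Proof.
move=> /sym_cauchyP uC /cvgnyPge s_oo e /uC[N NP].
have [M _ MP] := s_oo N.
exists M => k n Mk kn; apply: NP; first exact: MP.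
by apply: MP => /=; exact: leq_trans kn.
Qed.

Theorem corollary3p14 (R : realType) (X Y : Type)
    (d : quasi_metric R X) (rho : quasi_metric R Y) (f : X -> Y) :
  left_K_cauchy_regular d rho f ->
  cauchy_regular (sym_space d) (sym_space rho) f.
Proof.
move=> freg u uC; apply/sym_cauchyP => e e0; apply: contrapT => no_N.
have /choice[p pP] : forall N, exists p : nat * nat,
    [/\ (N <= p.1)%N, (N <= p.2)%N & e <= rho (f (u p.1)) (f (u p.2))].
  move=> N; apply: contrapT => no_p; apply: no_N; exists N => m n Nm Nn.
  by rewrite ltNge; apply/negP => emn; apply: no_p; exists (m, n).
pose s i := if odd i then (p i./2).2 else (p i./2).1.
have s_oo : s @ \oo --> \oo.
  apply/cvgnyPge => N; exists N.*2 => // i /= Ni.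
  have Ni2 : (N <= i./2)%N by rewrite geq_half_double.
  by have [p1 p2 _] := pP i./2; rewrite /s; case: ifP => _; exact: leq_trans Ni2 _.
(* Positions [N.*2] and [N.*2.+1] hold the two entries of [p N], and [N <= N.*2] puts them past the
   threshold [N]. *)
have [N /(_ N.*2 N.*2.+1)] := freg _ (sym_cauchy_comp_left_K _ _ _ _ _ uC s_oo) e e0.
rewrite /= /s /= odd_double /= uphalf_double doubleK -addnn leq_addr leqnSn.
by have [_ _] := pP N; rewrite leNgt => /negP + /(_ isT isT).
Qed.
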